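(* Let $\mathcal{H}_A,\mathcal{H}_B$ be complex Hilbert spaces of finite dimensions $d_A,d_B\ge 1$, let $n_s=\min(d_A,d_B)$, let $U\subset\mathcal{H}_A\otimes\mathcal{H}_B$ be a non-zero linear subspace with orthogonal projection $P$, let $p\geq 1$ be real and let $1\le k\leq n_s$ be an integer. Starting from any unit vector $|\psi_0\rangle\in U$, let $(|\psi_m\rangle)_{m\ge 0}$ be any sequence of unit vectors in $U$ generated by the iteration $$|\psi_{m+1}\rangle=\frac{P\left(\sum_{i=1}^k (\lambda_i^{\psi_m})^{p-1}\,|\psi^i_{m,A}\rangle\otimes|\psi^i_{m,B}\rangle\right)}{\left\|P\left(\sum_{i=1}^k (\lambda_i^{\psi_m})^{p-1}\,|\psi^i_{m,A}\rangle\otimes|\psi^i_{m,B}\rangle\right)\right\|},$$ where $|\psi_m\rangle=\sum_{i=1}^{n_s}\lambda_i^{\psi_m}|\psi^i_{m,A}\rangle\otimes|\psi^i_{m,B}\rangle$ is a Schmidt decomposition of $|\psi_m\rangle$. Then the sequence of real numbers $\||\psi_m\rangle\|_{p,k}$ is increasing (i.e. $\||\psi_{m}\rangle\|_{p,k}\le\||\psi_{m+1}\rangle\|_{p,k}$ for all $m$) and converges.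
   Context: A Schmidt decomposition of a vector $|\psi\rangle\in\mathcal{H}_A\otimes\mathcal{H}_B$ is an expression $|\psi\rangle=\sum_{i=1}^{n_s}\lambda_i^\psi|\psi_A^i\rangle\otimes|\psi_B^i\rangle$ with $\lambda_1^\psi\ge\dots\ge\lambda_{n_s}^\psi\ge 0$ (the Schmidt coefficients, uniquely determined by $|\psi\rangle$) and orthonormal families $|\psi_A^i\rangle\in\mathcal{H}_A$, $|\psi_B^i\rangle\in\mathcal{H}_B$ (the Schmidt vectors, in general not unique). The Schmidt norm is $\||\psi\rangle\|_{p,k}=\left(\sum_{i=1}^k(\lambda_i^\psi)^p\right)^{1/p}$. $\|\cdot\|$ without subscripts is the Hilbert space norm. When $p=1$, the factor $(\lambda_i^\psi)^{p-1}$ is read as $1$ (also when $\lambda_i^\psi=0$). *)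

(* Defs.v *)
From HB Require Import structures.
From mathcomp Require Import all_boot all_order all_algebra sesquilinear complex.
From mathcomp Require Import all_classical all_reals all_analysis.

Set Implicit Arguments.
Unset Strict Implicit.
Unset Printing Implicit Defensive.

Import Order.TTheory GRing.Theory Num.Theory Num.Def.
Import numFieldNormedType.Exports.

Local Open Scope ring_scope.
Local Open Scope complex_scope.

(* A finite-dimensional complex Hilbert space is a vectType over R[i] together
   with a positive definite form {dot _ for conjC} (linear on the left,
   conjugate-linear on the right). *)

Section Hilbert.
Variables (R : realType) (H : vectType R[i]) (ip : {dot H for conjC}).

(* Complex-valued, like every norm over a numClosedFieldType; it is a
   nonnegative real. *)
Definition hilbert_norm (v : H) : R[i] := sqrtC (ip v v).

(* The projection onto U along its orthogonal complement. *)
Definition orthogonal_projection (U : {vspace H}) : 'End(H) :=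
  daddv_pi U (orthov ip U).

End Hilbert.

Section Tensor.
Variables (R : realType) (HA HB H : vectType R[i]).
Variables (ipA : {dot HA for conjC}) (ipB : {dot HB for conjC}).
Variables (ip : {dot H for conjC}) (tens : {bilinear HA -> HB -> H}).

(* (H, tens) is the Hilbert space tensor product of HA and HB. The inner
   product condition alone makes the induced map from the algebraic tensor
   product to H injective and isometric; with the spanning condition it is a
   unitary isomorphism. *)
Definition hilbert_tensor_product : Prop :=
  (forall (a a' : HA) (b b' : HB),
     ip (tens a b) (tens a' b') = ipA a a' * ipB b b') /\
  (forall V : {vspace H}, (forall a b, tens a b \in V) -> V = fullv).

Definition schmidt_rank_bound : nat := minn (\dim {:HA}) (\dim {:HB}).
Local Notation ns := schmidt_rank_bound.

Definition schmidt_decomposition (psi : H)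
    (lam : ns.-tuple R) (a : ns.-tuple HA) (b : ns.-tuple HB) : Prop :=
  [/\ sorted >=%R lam,
      forall i, 0 <= tnth lam i,
      orthonormal ipA a,
      orthonormal ipB b &
      psi = \sum_(i < ns) (tnth lam i)%:C *: tens (tnth a i) (tnth b i)].

(* When H is the tensor product of HA and HB, every vector has a Schmidt
   decomposition and all of them share the same coefficients, so the choice
   made here is forced and the default value is never taken. *)
Definition schmidt_coefficients (psi : H) : ns.-tuple R :=
  xget [tuple of nseq ns 0]
    [set lam | exists a b, schmidt_decomposition psi lam a b]%classic.

Definition schmidt_norm (p : R) (k : nat) (psi : H) : R :=
  (\sum_(i < ns | (i < k)%N) tnth (schmidt_coefficients psi) i `^ p) `^ p^-1.

(* 0 `^ 0 = 1, so for p = 1 every factor lam_i `^ (p - 1) is 1. *)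
Definition truncated_schmidt_sum (p : R) (k : nat)
    (lam : ns.-tuple R) (a : ns.-tuple HA) (b : ns.-tuple HB) : H :=
  \sum_(i < ns | (i < k)%N)
    (tnth lam i `^ (p - 1))%:C *: tens (tnth a i) (tnth b i).

End Tensor.

(* Main.v *)
(* Let T_m be the truncated sum at step m.  Since psi_m and psi_(m+1) lie in U
   and psi_(m+1) is P T_m normalised, Cauchy-Schwarz gives
   sum_(i < k) lam_i ^ p = <psi_m, T_m> <= |<psi_(m+1), T_m>|.  Expanding both
   vectors in their Schmidt bases, the overlaps form a doubly substochastic
   matrix (by Bessel), so the right-hand side is at most
   sum_(i < k) lam_i ^ (p - 1) mu_i, where mu are the coefficients of
   psi_(m+1); Young's inequality turns this into
   sum_(i < k) lam_i ^ p <= sum_(i < k) mu_i ^ p.  The same rearrangement bound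
   shows that the Schmidt coefficients are unique. *)
Require Import Defs.
From HB Require Import structures.
From mathcomp Require Import all_boot all_order all_algebra sesquilinear complex.
From mathcomp Require Import all_classical all_reals all_analysis.

Set Implicit Arguments.
Unset Strict Implicit.
Unset Printing Implicit Defensive.

Import Order.TTheory GRing.Theory Num.Theory Num.Def.
Import numFieldNormedType.Exports.

Local Open Scope ring_scope.
Local Open Scope complex_scope.

(** * Abel summation and rearrangement for doubly substochastic matrices *)

Lemma abel_sum_ge0 (R : numDomainType) n (c x : 'I_n -> R) :
  (forall i, 0 <= c i) -> (forall i j : 'I_n, (i <= j)%N -> c j <= c i) ->
  (forall r : nat, 0 <= \sum_(i < n | (i < r)%N) x i) ->
  0 <= \sum_(i < n) c i * x i.
Proof.
move=> c_ge0 c_decr x_ge0.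
(* The lower bound [d] carries the induction: the last entry of [c] is its least, so it can replace
   [d] and then bound the remaining entries from below. *)
suff key d : (forall i, d <= c i) ->
    d * (\sum_(i < n) x i) <= \sum_(i < n) c i * x i.
  by have := key 0 c_ge0; rewrite mul0r.
elim: n c x d {c_ge0} c_decr x_ge0 => [|n IHn] c x d c_decr x_ge0 d_le.
  by rewrite !big_ord0 mulr0.
have X_ge0 : 0 <= \sum_(i < n.+1) x i.
  by have := x_ge0 n.+1; under eq_bigl => i do rewrite ltn_ord.
apply: (le_trans (ler_wpM2r X_ge0 (d_le ord_max))).
rewrite !big_ord_recr /= mulrDr lerD2r; apply: IHn => [i j ij|r|i].
- exact: c_decr.
(* Cutting at [minn r n] keeps the last entry out of the partial sum when [r > n]. *)
- have := x_ge0 (minn r n).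
  rewrite big_mkcond big_ord_recr /= ltnNge geq_minr addr0
    [in X in _ -> X]big_mkcond.
  by under eq_bigr => i _ do rewrite leq_min ltn_ord andbT.
- by apply: c_decr; rewrite /= ltnW.
Qed.

(* Abel summation, once in each variable, reduces to 0-1 sequences, where the
   bound is [\sum_(i < r) \sum_(j < s) D i j <= minn r s]. *)
Lemma substochastic_rearrangement (R : numDomainType) n
    (D : 'I_n -> 'I_n -> R) (c mu : 'I_n -> R) :
  (forall i j, 0 <= D i j) ->
  (forall i, \sum_j D i j <= 1) -> (forall j, \sum_i D i j <= 1) ->
  (forall i, 0 <= c i) -> (forall i j : 'I_n, (i <= j)%N -> c j <= c i) ->
  (forall i, 0 <= mu i) -> (forall i j : 'I_n, (i <= j)%N -> mu j <= mu i) ->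
  \sum_i \sum_j c i * mu j * D i j <= \sum_i c i * mu i.
Proof.
move=> D_ge0 Drow Dcol c_ge0 c_decr mu_ge0 mu_decr.
have partial_le (P : pred 'I_n) (F : 'I_n -> R) : (forall i, 0 <= F i) ->
    \sum_(i | P i) F i <= \sum_i F i.
  by move=> F_ge0; rewrite big_mkcond ler_sum // => i _; case: ifP.
rewrite -subr_ge0 -sumrB.
under eq_bigr => i _ do
  [under eq_bigr => j _ do rewrite -mulrA; rewrite -mulr_sumr -mulrBr].
apply: abel_sum_ge0 => // r; rewrite sumrB exchange_big /=.
rewrite [X in X - _]big_mkcond -sumrB.
(* Both sums now run over [j], so [mu j] becomes the weight of the second Abel summation; the cut at
   [r] turns into an indicator. *)
rewrite (eq_bigr (fun j => mu j *
    ((j < r)%N%:R - \sum_(i < n | (i < r)%N) D i j))); last first.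
  move=> j _; rewrite mulrBr -mulr_sumr; congr (_ - _).
  by case: (j < r)%N; rewrite ?mulr1 ?mulr0.
apply: abel_sum_ge0 => // s; rewrite sumrB subr_ge0.
(* If [r <= s], sum by rows, each contributing at most 1; otherwise sum by columns. *)
have [rs|/ltnW sr] := leqP r s.
  rewrite exchange_big /= [X in _ <= X]big_mkcond /=.
  rewrite [X in X <= _]big_mkcond /= ler_sum // => i _.
  case: ltnP => ir; last by case: ifP.
  by rewrite (leq_trans ir rs) (le_trans (partial_le _ _ _)).
by apply: ler_sum => j js; rewrite (leq_trans js sr) (le_trans (partial_le _ _ _)).
Qed.

(** * Bessel's inequality and orthogonal projection *)

Section Dot.
Variables (C : numClosedFieldType) (V : vectType C) (ip : {dot V for conjC}).

Lemma orthonormal_tnth n (e : n.-tuple V) i j :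
  orthonormal ip e -> ip (tnth e i) (tnth e j) = (i == j)%:R.
Proof.
case/orthonormalP=> e_uniq -> ; rewrite ?mem_tnth //.
by rewrite !(tnth_nth 0) nth_uniq ?size_tuple.
Qed.

Lemma dotC x y : ip y x = ((ip x y)^*)%R.
Proof. by rewrite hermC /= mul1r. Qed.

(** With [y] the projection of [x] onto the span of [e], the square norm of [x - y] is
    [ip x x - ip x y]. *)
Lemma bessel n (e : n.-tuple V) x : orthonormal ip e ->
  \sum_(i < n) `|ip x (tnth e i)| ^+ 2 <= ip x x.
Proof.
move=> e_on; pose y := \sum_(i < n) ip x (tnth e i) *: tnth e i.
have xy : ip x y = \sum_(i < n) `|ip x (tnth e i)| ^+ 2.
  rewrite linear_sumr; apply: eq_bigr => i _.
  by rewrite linearZr_LR /= normCK mulrC.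
have yy : ip y y = ip x y.
  rewrite {2}/y !linear_sumr; apply: eq_bigr => i _; rewrite !linearZr_LR /=.
  congr (_ * _); rewrite linear_sumlz (bigD1 i) //= big1 => [|j ji].
    by rewrite linearZl_LR /= orthonormal_tnth // eqxx mulr1 addr0.
  by rewrite linearZl_LR /= orthonormal_tnth // (negPf ji) mulr0.
have := dnorm_ge0 ip (x - y); rewrite dnormB /= yy xy => xy_ge0.
rewrite -subr_ge0; move: xy_ge0; rewrite geC0_conj ?opprD ?addrA ?addrK //.
by apply: sumr_ge0 => i _; rewrite exprn_ge0.
Qed.

End Dot.

(** Termwise [2uv <= u^2 + v^2], then Bessel in each space. This will bound the row and column sums
    of the overlap matrix of two Schmidt decompositions. *)
Lemma sum_norm_dot_mul_le1 (C : numClosedFieldType) (V W : vectType C)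
    (ip : {dot V for conjC}) (iq : {dot W for conjC}) n
    (e : n.-tuple V) (f : n.-tuple W) x y :
  orthonormal ip e -> orthonormal iq f -> ip x x = 1 -> iq y y = 1 ->
  \sum_(i < n) `|ip x (tnth e i)| * `|iq y (tnth f i)| <= 1.
Proof.
move=> e_on f_on x1 y1.
have /le_trans : \sum_(i < n) `|ip x (tnth e i)| * `|iq y (tnth f i)| *+ 2 <=
    \sum_(i < n) (`|ip x (tnth e i)| ^+ 2 + `|iq y (tnth f i)| ^+ 2).
  apply: ler_sum => i _; rewrite -subr_ge0 addrAC -sqrrB.
  by rewrite real_exprn_even_ge0 // rpredB ?normr_real.
rewrite big_split /= sumrMnl => /(_ (1 *+ 2)).
rewrite ler_pMn2r // => -> //.
by have := lerD (bessel x e_on) (bessel y f_on); rewrite x1 y1 mulr2n.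
Qed.

Section Projection.
Variables (R : realType) (H : vectType R[i]) (ip : {dot H for conjC}).
Variable (U : {vspace H}).

Lemma dot_orthogonal_projection u x : u \in U ->
  ip u (orthogonal_projection ip U x) = ip u x.
Proof.
(* [daddv_pi] splits [x] correctly only if the two subspaces meet trivially, which is definiteness,
   and their sum contains [x], which follows by splitting along a basis of [U]. *)
move=> uU; have cap0 : (U :&: orthov ip U = 0)%VS.
  apply/eqP; rewrite -subv0; apply/subvP => v /memv_capP[vU /mem_orthovP vO].
  by rewrite memv0 -(dnorm_eq0 ip) vO.
have xUO : x \in (U + orthov ip U)%VS.
  have [y yU [z [-> _ /orthoPl zU]]] := orthogonal_split ip (vbasis U) x.
  rewrite (span_basis (vbasisP U)) in yU.
  apply: memv_add => //; apply/mem_orthovP => v vU.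
  rewrite (coord_vbasis vU) linear_sumr big1 // => i _.
  by rewrite linearZr_LR /= zU ?mulr0 // mem_nth // size_tuple.
have /mem_orthovP/(_ u uU) perp := memv_pi (orthov ip U) U x.
by rewrite -{2}(daddv_pi_add cap0 xUO) linearDr /=
  [X in _ + X]dotC perp conjC0 addr0.
Qed.

End Projection.

(** Young's inequality with exponents [p / (p - 1)] and [p] bounds each mixed term by
    [(1 - 1/p) x^p + y^p / p]; cancelling the [x^p] part leaves a factor [1/p] on both sides. *)
Lemma young_powR_sum (R : realType) (I : finType) (P : pred I) (p : R)
    (x y : I -> R) :
  1 <= p ->
  (forall i, 0 <= x i) -> (forall i, 0 <= y i) ->
  \sum_(i | P i) x i `^ p <= \sum_(i | P i) x i `^ (p - 1) * y i ->
  \sum_(i | P i) x i `^ p <= \sum_(i | P i) y i `^ p.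
Proof.
move=> p_ge1 x_ge0 y_ge0; have p_gt0 : 0 < p by rewrite (lt_le_trans ltr01).
(* At [p = 1] there is no finite conjugate exponent, but the mixed terms are then just [y i]. *)
have [->|p_neq1] := eqVneq p 1.
  move/le_trans; apply; apply: ler_sum => i _.
  by rewrite subrr powRr0 mul1r powRr1.
have p_gt1 : 0 < p - 1 by rewrite subr_gt0 lt_neqAle eq_sym p_neq1.
have young i : x i `^ (p - 1) * y i <= x i `^ p * ((p - 1) / p) + y i `^ p / p.
  have := @conjugate_powR R (x i `^ (p - 1)) (y i) (p / (p - 1)) p.
  rewrite -powRrM [(p - 1) * _]mulrC divfK ?gt_eqF // invf_div => -> //.
  - exact: powR_ge0.
  - exact: divr_gt0.
  - by rewrite mulrBl divff ?gt_eqF // mul1r subrK.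
move/le_trans/(_ (ler_sum _ (fun i _ => young i))).
rewrite big_split /= -!mulr_suml mulrBl divff ?gt_eqF // mul1r mulrBr mulr1.
by rewrite -addrA lerDl addrC subr_ge0 ler_pM2r ?invr_gt0 //.
Qed.

(** * Overlaps of Schmidt decompositions and uniqueness of the coefficients *)

Section Schmidt.
Variables (R : realType) (HA HB H : vectType R[i]).
Variables (ipA : {dot HA for conjC}) (ipB : {dot HB for conjC}).
Variables (ip : {dot H for conjC}) (tens : {bilinear HA -> HB -> H}).
Hypothesis tensP : hilbert_tensor_product ipA ipB ip tens.
Local Notation ns := (schmidt_rank_bound HA HB).
Local Notation schmidt := (schmidt_decomposition ipA ipB tens).
Implicit Types (psi : H) (lam mu : ns.-tuple R).
Implicit Types (a : ns.-tuple HA) (b : ns.-tuple HB).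
Implicit Types (c : 'I_ns -> R).

Lemma schmidt_decr psi lam a b (i j : 'I_ns) :
  schmidt psi lam a b -> (i <= j)%N -> tnth lam j <= tnth lam i.
Proof.
case=> lam_sorted _ _ _ _ ij; rewrite !(tnth_nth 0).
have ge_tr : transitive (>=%R : rel R) by move=> x y z xy zx; exact: le_trans zx xy.
have ge_refl : reflexive (>=%R : rel R) by move=> x; exact: lexx.
by apply: (sorted_leq_nth ge_tr ge_refl 0 lam_sorted); rewrite ?inE ?size_tuple.
Qed.

Lemma dot_schmidt_sum psi lam a b c a' b' : schmidt psi lam a b ->
  ip psi (\sum_i (c i)%:C *: tens (tnth a' i) (tnth b' i)) =
  \sum_i \sum_j (c i)%:C * (tnth lam j)%:C *
    (ipA (tnth a j) (tnth a' i) * ipB (tnth b j) (tnth b' i)).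
Proof.
case=> _ _ _ _ ->; rewrite linear_sumr; apply: eq_bigr => i _.
rewrite linear_sumlz; apply: eq_bigr => j _.
rewrite linearZr_LR linearZl_LR /= (proj1 tensP) -mulrA; congr (_ * _).
exact: conjc_real.
Qed.

Lemma dot_schmidt_self psi lam a b c : schmidt psi lam a b ->
  ip psi (\sum_i (c i)%:C *: tens (tnth a i) (tnth b i)) =
  (\sum_i c i * tnth lam i)%:C.
Proof.
move=> psiP; have [_ _ a_on b_on _] := psiP.
rewrite (dot_schmidt_sum _ _ _ psiP) rmorph_sum; apply: eq_bigr => i _.
rewrite (bigD1 i) //= big1 => [|j ji].
  by rewrite addr0 !orthonormal_tnth // eqxx !mulr1 rmorphM.
by rewrite !orthonormal_tnth // (negPf ji) !mulr0.
Qed.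

(** Triangle inequality, then rearrangement for the products of absolute overlaps. General weights
    [c] cover both the indicators used for uniqueness and the powers used in the iteration. *)
Lemma dot_schmidt_le psi mu a b c a' b' : schmidt psi mu a b ->
  orthonormal ipA a' -> orthonormal ipB b' ->
  (forall i, 0 <= c i) -> (forall i j : 'I_ns, (i <= j)%N -> c j <= c i) ->
  `|ip psi (\sum_i (c i)%:C *: tens (tnth a' i) (tnth b' i))| <=
  (\sum_i c i * tnth mu i)%:C.
Proof.
move=> psiP a'_on b'_on c_ge0 c_decr; have [_ mu_ge0 a_on b_on _] := psiP.
rewrite (dot_schmidt_sum _ _ _ psiP).
apply: le_trans (ler_norm_sum _ _ _) _.
have /le_trans -> // :
    \sum_i `|\sum_j (c i)%:C * (tnth mu j)%:C *
      (ipA (tnth a j) (tnth a' i) * ipB (tnth b j) (tnth b' i))| <=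
    \sum_i \sum_j (c i)%:C * (tnth mu j)%:C *
      (`|ipA (tnth a j) (tnth a' i)| * `|ipB (tnth b j) (tnth b' i)|).
  apply: ler_sum => i _; apply: le_trans (ler_norm_sum _ _ _) _.
  by apply: ler_sum => j _; rewrite !normrM (ger0_norm (x := (c i)%:C)) ?ler0c //
    (ger0_norm (x := (tnth mu j)%:C)) ?ler0c.
rewrite rmorph_sum /=; under [X in _ <= X]eq_bigr => i _ do rewrite rmorphM.
apply: (@substochastic_rearrangement _ _
  (fun i j => `|ipA (tnth a j) (tnth a' i)| * `|ipB (tnth b j) (tnth b' i)|)
  (fun i => (c i)%:C) (fun j => (tnth mu j)%:C)) => [i j|i|j|i|i j ij|i|i j ij].
- by rewrite mulr_ge0.
(* In a row sum the fixed vector is the second argument; swapping only conjugates the overlaps. *)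
- under eq_bigr => j _ do rewrite dotC (dotC ipB) !norm_conjC.
  by apply: sum_norm_dot_mul_le1; rewrite ?orthonormal_tnth ?eqxx.
- by apply: sum_norm_dot_mul_le1; rewrite ?orthonormal_tnth ?eqxx.
- by rewrite ler0c.
- by rewrite lecR c_decr.
- by rewrite ler0c.
- by rewrite lecR (schmidt_decr psiP).
Qed.

(** The left side is the overlap of [psi] with the [c]-weighted sum built on [a] and [b]; the second
    decomposition of [psi] bounds that same overlap. *)
Lemma schmidt_sum_le psi lam a b mu a' b' c :
  schmidt psi lam a b -> schmidt psi mu a' b' ->
  (forall i, 0 <= c i) -> (forall i j : 'I_ns, (i <= j)%N -> c j <= c i) ->
  \sum_i c i * tnth lam i <= \sum_i c i * tnth mu i.
Proof.
move=> psiP psiP' c_ge0 c_decr; have [_ lam_ge0 a_on b_on _] := psiP.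
have := dot_schmidt_le psiP' a_on b_on c_ge0 c_decr.
rewrite (dot_schmidt_self _ psiP) ger0_norm ?lecR //.
by apply: sumr_ge0 => i _; rewrite mulr_ge0.
Qed.

(** Taking for [c] the indicator of [i < r], in both directions, equates all partial sums;
    consecutive ones differ by a single coefficient. *)
Lemma schmidt_unique psi lam a b mu a' b' :
  schmidt psi lam a b -> schmidt psi mu a' b' -> lam = mu.
Proof.
move=> psiP psiP'.
have partial r :
    \sum_(i < ns | (i < r)%N) tnth lam i = \sum_(i < ns | (i < r)%N) tnth mu i.
  have c_ge0 (i : 'I_ns) : 0 <= (i < r)%N%:R :> R by [].
  have c_decr (i j : 'I_ns) : (i <= j)%N -> (j < r)%N%:R <= (i < r)%N%:R :> R.
    by move=> ij; rewrite ler_nat; case: ltnP => // /(leq_ltn_trans ij) ->.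
  have truncE (nu : ns.-tuple R) :
      \sum_(i < ns) (i < r)%N%:R * tnth nu i = \sum_(i < ns | (i < r)%N) tnth nu i.
    by rewrite [RHS]big_mkcond; apply: eq_bigr => i _; rewrite mulr_natl mulrb.
  by apply: le_anti; rewrite -!truncE
    (schmidt_sum_le psiP psiP') ?(schmidt_sum_le psiP' psiP).
apply: eq_from_tnth => i; have := partial i.+1.
rewrite (bigD1 i) //= [in X in _ = X](bigD1 i) //=.
have eq_lt (j : 'I_ns) : (j < i.+1)%N && (j != i) = (j < i)%N.
  by rewrite ltnS [RHS]ltn_neqAle andbC.
under eq_bigl do rewrite eq_lt.
by under [in X in _ = X -> _]eq_bigl do rewrite eq_lt; rewrite (partial i) => /addIr.
Qed.

Lemma schmidt_coefficientsE psi lam a b :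
  schmidt psi lam a b -> schmidt_coefficients ipA ipB tens psi = lam.
Proof.
move=> psiP; rewrite /schmidt_coefficients; case: xgetP => [mu _|/(_ lam) []].
  by case=> a' [b' psiP']; exact: schmidt_unique psiP' psiP.
by exists a, b.
Qed.

(** The coefficient is the inner product of [psi] with the unit vector [tens (tnth a i) (tnth b i)],
    so Cauchy-Schwarz applies. *)
Lemma schmidt_coefficient_le1 psi lam a b i :
  schmidt psi lam a b -> ip psi psi = 1 -> tnth lam i <= 1.
Proof.
move=> psiP psi1; have [_ lam_ge0 a_on b_on _] := psiP.
have := dot_schmidt_self (fun j => (j == i)%:R) psiP.
rewrite (bigD1 i) //= big1 => [|j /negPf ->]; last by rewrite scale0r.
rewrite (bigD1 i) //= [in X in _ = X]big1 => [|j /negPf ->]; last by rewrite mul0r.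
rewrite eqxx scale1r !addr0 mul1r => ip_i.
have := CauchySchwarz ip psi (tens (tnth a i) (tnth b i)).
rewrite ip_i psi1 (proj1 tensP) !orthonormal_tnth // eqxx !mulr1 => -[].
by rewrite ger0_norm ?ler0c // expr_le1 ?ler0c // lecR.
Qed.

End Schmidt.

(** * Monotonicity and boundedness along the iteration *)

Theorem theorem4p1 (R : realType) (HA HB H : vectType R[i])
    (ipA : {dot HA for conjC}) (ipB : {dot HB for conjC})
    (ip : {dot H for conjC}) (tens : {bilinear HA -> HB -> H})
    (tensP : hilbert_tensor_product ipA ipB ip tens)
    (dA_gt0 : (1 <= \dim {:HA})%N) (dB_gt0 : (1 <= \dim {:HB})%N)
    (U : {vspace H}) (U_neq0 : U != 0%VS)
    (p : R) (p_ge1 : 1 <= p)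
    (k : nat) (k_bounds : (1 <= k <= schmidt_rank_bound HA HB)%N)
    (psi : nat -> H)
    (psi_in : forall m, psi m \in U)
    (psi_unit : forall m, hilbert_norm ip (psi m) = 1)
    (lam : nat -> (schmidt_rank_bound HA HB).-tuple R)
    (a : nat -> (schmidt_rank_bound HA HB).-tuple HA)
    (b : nat -> (schmidt_rank_bound HA HB).-tuple HB)
    (schmidtP : forall m,
       schmidt_decomposition ipA ipB tens (psi m) (lam m) (a m) (b m))
    (iterP : forall m,
       let w := orthogonal_projection ip U
                  (truncated_schmidt_sum tens p k (lam m) (a m) (b m)) in
       psi m.+1 = (hilbert_norm ip w)^-1 *: w) :
  (forall m, schmidt_norm ipA ipB tens p k (psi m)
             <= schmidt_norm ipA ipB tens p k (psi m.+1)) /\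
  cvgn (fun m => schmidt_norm ipA ipB tens p k (psi m)).
Proof.
have psi1 m : ip (psi m) (psi m) = 1.
  by rewrite -[LHS]sqrtCK -/(hilbert_norm ip (psi m)) psi_unit expr1n.
have lam_ge0 m i : 0 <= tnth (lam m) i by case: (schmidtP m).
have normE m : schmidt_norm ipA ipB tens p k (psi m) =
    (\sum_(i < schmidt_rank_bound HA HB | (i < k)%N) tnth (lam m) i `^ p) `^ p^-1.
  by rewrite /schmidt_norm (schmidt_coefficientsE tensP (schmidtP m)).
have p_gt0 : 0 < p by rewrite (lt_le_trans ltr01).
have p_ge0 := ltW p_gt0.
have incr m : schmidt_norm ipA ipB tens p k (psi m) <=
    schmidt_norm ipA ipB tens p k (psi m.+1).
  rewrite !normE ge0_ler_powR ?invr_ge0 ?nnegrE //;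
    do ?[by apply: sumr_ge0 => i _; exact: powR_ge0].
  apply: (young_powR_sum (x := tnth (lam m)) (y := tnth (lam m.+1))) => //.
  (* Extending the weights by zero past [k] turns truncated sums into full ones and keeps the
     weights nonincreasing, since [p - 1 >= 0]. *)
  pose c (i : 'I_(schmidt_rank_bound HA HB)) : R :=
    if (i < k)%N then tnth (lam m) i `^ (p - 1) else 0.
  have c_ge0 i : 0 <= c i by rewrite /c; case: ifP; rewrite ?powR_ge0.
  have c_decr (i j : 'I_(schmidt_rank_bound HA HB)) : (i <= j)%N -> c j <= c i.
    move=> ij; rewrite /c; case: ltnP => [jk|_]; last exact: c_ge0.
    rewrite (leq_ltn_trans ij jk) ge0_ler_powR ?subr_ge0 ?nnegrE //.
    exact: schmidt_decr (schmidtP m) ij.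
  pose T := \sum_i (c i)%:C *: tens (tnth (a m) i) (tnth (b m) i).
  have TE : truncated_schmidt_sum tens p k (lam m) (a m) (b m) = T.
    rewrite /truncated_schmidt_sum big_mkcond; apply: eq_bigr => i _.
    by rewrite /c; case: ifP => // _; rewrite scale0r.
  pose w := orthogonal_projection ip U T.
  have psiS : psi m.+1 = (hilbert_norm ip w)^-1 *: w by rewrite iterP TE.
  (* As [0^-1 = 0], a vanishing norm would make [psi m.+1] zero, not a unit vector. *)
  have w_neq0 : hilbert_norm ip w != 0.
    apply/eqP => w0; have := psi1 m.+1.
    by rewrite psiS w0 invr0 scale0r linear0l => /eqP; rewrite eq_sym oner_eq0.
  have wE : w = hilbert_norm ip w *: psi m.+1 by rewrite psiS scalerKV.
  have dotT n : ip (psi n) T = ip (psi n) w.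
    by rewrite dot_orthogonal_projection.
  (* Against vectors of [U], [T] acts as [w], a multiple of [psi m.+1], so among unit vectors of [U]
     the overlap is largest at [psi m.+1]. *)
  have dot_le : `|ip (psi m) T| <= `|ip (psi m.+1) T|.
    rewrite !dotT wE !linearZr_LR !normrM /= psi1 normr1 ler_wpM2l //.
    rewrite -(@expr_le1 _ 2) //; have := (CauchySchwarz ip (psi m) (psi m.+1)).1.
    by rewrite !psi1 mulr1.
  have [_ _ a_on b_on _] := schmidtP m.
  have := le_trans dot_le
    (dot_schmidt_le tensP (schmidtP m.+1) a_on b_on c_ge0 c_decr).
  rewrite (dot_schmidt_self tensP c (schmidtP m)) ger0_norm ?lecR; last first.
    by apply: sumr_ge0 => i _; rewrite mulr_ge0.
  have cE (x : 'I_(schmidt_rank_bound HA HB) -> R) : \sum_i c i * x i =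
      \sum_(i < schmidt_rank_bound HA HB | (i < k)%N)
        tnth (lam m) i `^ (p - 1) * x i.
    rewrite [RHS]big_mkcond; apply: eq_bigr => i _.
    by rewrite /c; case: ifP => // _; rewrite mul0r.
  rewrite !cE [X in X <= _ -> _](eq_bigr (fun i => tnth (lam m) i `^ p)) // => i _.
  by rewrite mulrC mulr_powRB1.
split=> //; apply: nondecreasing_is_cvgn.
  by apply/nondecreasing_seqP.
(* Each coefficient is at most 1, so the sum of [p]-th powers is at most the number of
   coefficients. *)
exists ((schmidt_rank_bound HA HB)%:R `^ p^-1) => _ [m _ <-]; rewrite normE.
rewrite ge0_ler_powR ?invr_ge0 ?nnegrE //.
  by apply: sumr_ge0 => i _; exact: powR_ge0.
rewrite big_mkcond -[X in _ <= X%:R]card_ord -sumr_const ler_sum // => i _.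
case: ifP => _ //; apply: (@le_trans _ _ (1 `^ p)); last by rewrite powR1.
rewrite ge0_ler_powR ?nnegrE //.
exact: schmidt_coefficient_le1 (schmidtP m) (psi1 m).
Qed.
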